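(* Let $n\ge 1$, let $G=(V,E)$ be a connected, undirected graph with self-loops on $V=\{1,\dots,n\}$, let $t_0<t_f$ be real numbers, and let $T\in\mathbb{R}^{n\times n}$. There exists a piecewise continuous $W:[t_0,t_f]\to\mathbb{R}^{n\times n}$ with $W(t)\in\mathrm{sparse}(G)$ for all $t\in[t_0,t_f]$ such that the solution $\mathbf{X}$ of $$\dot{\mathbf{X}}(t)=W(t)\mathbf{X}(t),\qquad \mathbf{X}(t_0)=I,$$ satisfies $\mathbf{X}(t_f)=T$, if and only if $T\in \mathrm{GL}_+^n(\mathbb{R})$.
   Context: $G=(V,E)$ with $V=\{1,\dots,n\}$ and $E\subset V\times V$ such that $(i,i)\in E$ for all $i\in V$ and $(i,j)\in E\Leftrightarrow (j,i)\in E$ (undirected with self-loops). For an $n\times n$ real matrix $M$, $M\in\mathrm{sparse}(G)$ means that $(i,j)\notin E\Rightarrow M_{ij}=0$ ($M$ need not be symmetric). $\mathrm{GL}_+^n(\mathbb{R})$ is the set of real $n\times n$ matrices with positive determinant, and $I$ is the $n\times n$ identity matrix. For piecewise continuous $W$, the solution $\mathbf{X}$ is the continuous matrix function satisfying the differential equation at all points of continuity of $W$ (equivalently, the associated integral equation). *)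

(* Defs.v *)
From HB Require Import structures.
From mathcomp Require Import all_boot all_order all_algebra.
From mathcomp Require Import all_classical all_reals all_analysis.

Set Implicit Arguments.
Unset Strict Implicit.
Unset Printing Implicit Defensive.

Import Order.TTheory GRing.Theory Num.Theory.
Import numFieldNormedType.Exports.

Local Open Scope classical_set_scope.
Local Open Scope ring_scope.

(* A graph on n vertices is given by its edge relation E : rel 'I_n.
   A function on [a, b] is represented by a total function on R; the
   definitions below only depend on its values on [a, b]. *)

Definition undirected_with_loops (n : nat) (E : rel 'I_n) : Prop :=
  reflexive E /\ symmetric E.

Definition connected_graph (n : nat) (E : rel 'I_n) : Prop :=
  forall i j : 'I_n, connect E i j.

Definition sparse (R : realType) (n : nat) (E : rel 'I_n) : set 'M[R]_n :=
  [set M | forall i j : 'I_n, ~~ E i j -> M i j = 0].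

Definition continuous_within_at (R : realType) (V : normedModType R)
    (A : set R) (f : R -> V) (t : R) : Prop :=
  f s @[s --> within A (nbhs t)] --> f t.

(* The derivative is relative to A: one-sided at the endpoints of an interval,
   the usual derivative at interior points of A. *)
Definition has_derivative_within (R : realType) (V : normedModType R)
    (A : set R) (f : R -> V) (t : R) (l : V) : Prop :=
  (s - t)^-1 *: (f s - f t) @[s --> within A t^'] --> l.

Definition piecewise_continuous (R : realType) (V : normedModType R)
    (a b : R) (f : R -> V) : Prop :=
  [/\ finite_set [set t | t \in `[a, b] /\ ~ continuous_within_at `[a, b] f t],
      forall t, t \in `[a, b[ -> exists l : V, f s @[s --> t^'+] --> l
    & forall t, t \in `]a, b] -> exists l : V, f s @[s --> t^'-] --> l].

(* At a discontinuity of W the differential equation is not imposed; there X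
   is only required to be continuous. *)
Definition is_solution (R : realType) (n : nat) (t0 tf : R)
    (W X : R -> 'M[R]_n) : Prop :=
  [/\ {within `[t0, tf], continuous X},
      X t0 = 1%:M
    & forall t, t \in `[t0, tf] -> continuous_within_at `[t0, tf] W t ->
        has_derivative_within `[t0, tf] X t (W t *m X t)].

Definition GLplus (R : realType) (n : nat) : set 'M[R]_n :=
  [set M | 0 < \det M].

(* Main.v *)
Require Import Defs.
From HB Require Import structures.
From mathcomp Require Import all_boot all_order all_algebra.
From mathcomp Require Import all_classical all_reals all_analysis.
From mathcomp Require Import ring lra.

Import Order.TTheory GRing.Theory Num.Theory.
Import numFieldNormedType.Exports.

Local Open Scope classical_set_scope.
Local Open Scope ring_scope.

(** Invertibility is preserved by the flow, and elementary matrices can be reached.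

Only if: the flow cannot lose rank.  If X(s) killed a vector v, then x = X v
would be a solution of the vector equation x' = W x that vanishes at time s but
starts from v <> 0.  A piecewise continuous W is bounded on the segment
([piecewise_continuous_bounded]), so for a suitable constant C the function
exp(C t) |x(t)|^2 has nonnegative derivative off the finitely many
discontinuities of W, and hence is nondecreasing
([derive_ge0_off_finite_le]); being 0 at s, it would be 0 at the initial time
([solution_nonsingular]).  So det X never vanishes; it is continuous and
starts at 1, so it is positive at the final time ([solution_det_gt0]).

If: the matrices that can be reached form a multiplicatively closed set, since
two motions can be run one after the other.  For an edge (i, j) the matrix
1 + s E_ij is reached by letting the coefficient of E_ij move from 0 to s; the
corresponding W is a multiple of E_ij, hence sparse ([steers_elem]).  Loops
give the diagonal matrices that rescale one coordinate by a positive factor,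
and the other edges give transvections.  Commutators of transvections along a
path multiply into the transvection joining its endpoints, so connectedness
provides the transvections for all pairs ([connected_elem_mx]).  Gaussian
elimination shows that these matrices generate all matrices of positive
determinant ([elem_mx_generate_GLplus]).

The coefficients move along a C^1 step that is constant outside the time
interval ([smooth_step]).  Each motion is then differentiable on the whole
line, with W continuous and equal to 0 outside its interval, and running two
motions in succession is just adding the W and multiplying the X, with no
gluing at the junction ([steers_mul]).  In particular W can even be taken
continuous. *)

Set Implicit Arguments.
Unset Strict Implicit.

(** * Matrix-valued functions *)

Lemma cvg_entrywise (R : realType) (m n : nat) (T : Type) (F : set_system T)
    (FF : Filter F) (f : T -> 'M[R]_(m, n)) (l : 'M[R]_(m, n)) :
  (forall i j, f x i j @[x --> F] --> l i j) -> f x @[x --> F] --> l.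
Proof.
move=> fl; apply/cvgrPdist_le => /= e e0.
near=> x.
rewrite /Num.Def.normr/= mx_normrE (bigmax_le _ (ltW e0))//= => i _.
rewrite !mxE/=.
move: i; near: x; apply: filter_forall => /= i.
exact: ((cvgrPdist_le _ _).1 (fl i.1 i.2)).
Unshelve. all: by end_near. Qed.

Lemma cvg_entry (R : realType) (m n : nat) (T : Type) (F : set_system T)
    (FF : Filter F) (f : T -> 'M[R]_(m, n)) (l : 'M[R]_(m, n)) i j :
  f x @[x --> F] --> l -> f x i j @[x --> F] --> l i j.
Proof.
move=> fl; apply: (cvg_comp f (fun M : 'M[R]_(m, n) => M i j) fl).
exact: coord_continuous.
Qed.

(** Bridge between the library's derivative, whose increment tends to 0, and a
difference quotient in the moving point s; only the latter can be restricted to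
a subset of the line, as one-sided derivatives require. *)
Lemma is_derive_difference_quotient (R : realType) (f : R -> R) (t l : R) :
  is_derive t 1 f l <-> (s - t)^-1 * (f s - f t) @[s --> t^'] --> l.
Proof.
have E (h : R -> R) : h s @[s --> t^'] --> l <-> h (s + t) @[s --> 0^'] --> l.
  split=> /cvgrPdist_lt hl; apply/cvgrPdist_lt => e /hl [d /= d0 H]; exists d => //= s.
  - rewrite /= sub0r normrN => sd s0; apply: H => /=.
      by rewrite opprD addrCA subrr addr0 normrN.
    by rewrite -subr_eq0 addrK.
  - move=> /= ts st; have := H (s - t); rewrite /= sub0r normrN distrC subrK.
    by rewrite subr_eq0; apply.
rewrite E; under [X in X @ _ --> _]eq_fun do rewrite addrK.
split.
- case=> df <-; move: df; rewrite /derivable /derive => /cvg_ex[l' hl'].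
  rewrite (cvg_lim _ hl') //; move: hl'.
  by under eq_fun do rewrite /= scaler1.
- move=> h.
  have h' : h0^-1 *: ((f \o shift t) (h0 *: (1:R)) - f t) @[h0 --> 0^'] --> l.
    by under eq_fun do rewrite /= scaler1.
  split; first by apply/cvg_ex; exists l.
  exact: cvg_lim h'.
Qed.

Lemma det_cvg (R : realType) (n : nat) (T : Type) (F : set_system T)
    (FF : Filter F) (f : T -> 'M[R]_n) (l : 'M[R]_n) :
  f x @[x --> F] --> l -> \det (f x) @[x --> F] --> \det l.
Proof.
move=> fl; apply: cvg_big => [|s _].
- exact: add_continuous.
- apply: cvgM; first exact: cvg_cst.
apply: cvg_big => [|i _].
- exact: mul_continuous.
exact: cvg_entry.
Qed.

Lemma is_derive_mulmx (R : realType) (n : nat) (X Y : R -> 'M[R]_n) (t : R)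
    (dX dY : 'M[R]_n) (i j : 'I_n) :
  (forall k, is_derive t 1 (fun s => X s i k) (dX i k)) ->
  (forall k, is_derive t 1 (fun s => Y s k j) (dY k j)) ->
  is_derive t 1 (fun s => (X s *m Y s) i j) ((dX *m Y t + X t *m dY) i j).
Proof.
move=> dXi dYj.
have -> : (fun s => (X s *m Y s) i j) = \sum_k (fun s => X s i k * Y s k j).
  by apply/funext => s; rewrite fct_sumE mxE.
apply: is_derive_eq.
rewrite !mxE -big_split /=; apply: eq_bigr => k _.
by rewrite /GRing.scale /= addrC; congr (_ + _); rewrite mulrC.
Qed.

Lemma continuous_piecewise (R : realType) (V : normedModType R) (a b : R)
    (f : R -> V) : continuous f -> piecewise_continuous a b f.
Proof.
move=> fc; split.
- rewrite [X in finite_set X](_ : _ = set0) //; apply/seteqP; split=> // t [_]; apply.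
  by apply: cvg_within_filter; exact: fc.
- by move=> t _; exists (f t); exact/cvg_at_right_filter/fc.
- by move=> t _; exists (f t); exact/cvg_at_left_filter/fc.
Qed.

(** * Solutions stay invertible *)

(** Finitely many points without information on the derivative are harmless:
cut the interval at each of them, use the mean value theorem on the open
pieces, and chain the inequalities by continuity. *)
Lemma derive_ge0_off_finite_le (R : realType) (D : seq R) (f df : R -> R) (a b : R) :
  a <= b -> {within `[a, b], continuous f} ->
  (forall t, t \in `]a, b[ -> t \notin D -> is_derive t 1 f (df t) /\ 0 <= df t) ->
  f a <= f b.
Proof.
elim: D a b => [|d D IH] a b ab cf df_ge0.
  (* The mean value theorem may return an endpoint, where df is unconstrained;
     the maximum with 0 covers that case. *)
  have [t /df_ge0[//|dft df0]|c _ E] :=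
      MVT_segment (df := fun t => Num.max 0 (df t)) ab _ cf.
    by rewrite max_r.
  by rewrite -subr_ge0 E mulr_ge0 ?subr_ge0// le_max lexx.
case: (boolP (d \in `]a, b[)) => [|dab]; last first.
  apply: IH => // t tab tD; apply: df_ge0 => //; rewrite inE negb_or tD andbT.
  by apply: contraNneq dab => <-.
rewrite in_itv /= => /andP[ad db]; apply: (@le_trans _ _ (f d)).
- apply: IH; first exact: ltW.
    apply: continuous_subspaceW cf.
    by apply: subset_itvl; rewrite bnd_simp ltW.
  move=> t; rewrite in_itv /= => /andP[at_ td] tD.
  apply: df_ge0; first by rewrite in_itv /= at_ (lt_trans td db).
  by rewrite inE negb_or tD (lt_eqF td).
- apply: IH; first exact: ltW.
    apply: continuous_subspaceW cf.
    by apply: subset_itvr; rewrite bnd_simp ltW.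
  move=> t; rewrite in_itv /= => /andP[dt tb] tD.
  apply: df_ge0; first by rewrite in_itv /= tb (lt_trans ad dt).
  by rewrite inE negb_or tD (gt_eqF dt).
Qed.

(** The one-sided limits bound f near every point of the segment, and the value
at the point itself is a third bound; compactness makes the bound uniform. *)
Lemma piecewise_continuous_bounded (R : realType) (V : normedModType R) (a b : R)
    (f : R -> V) :
  piecewise_continuous a b f ->
  exists M, forall t, t \in `[a, b] -> `|f t| <= M.
Proof.
move=> [_ fr fl].
have side (F : set_system R) (FF : Filter F) l : f s @[s --> F] --> l ->
    \forall s \near F, `|f s| <= `|l| + 1.
  move=> /cvgrPdist_le /(_ _ ltr01); apply: filterS => s ls.
  rewrite -lerBlDl; apply: le_trans ls.
  by rewrite distrC; exact: lerB_dist.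
have loc x : x \in `[a, b] ->
    \forall x' \near x & M \near +oo, x' \in `[a, b] -> `|f x'| <= M.
  rewrite /= in_itv /= => /andP[ax xb].
  have [Mr Hr] : exists M, \forall s \near x^'+, s \in `[a, b] -> `|f s| <= M.
    have [xb'|bx] := ltP x b.
      have [|l /side Hl] := fr x; first by rewrite in_itv /= ax.
      by exists (`|l| + 1); apply: filterS Hl => s ->.
    exists 0; near=> s.
    rewrite in_itv /= => /andP[_ sb].
    have : x < s by near: s; exact: nbhs_right_gt.
    by rewrite ltNge (le_trans sb bx).
  have [Ml Hl] : exists M, \forall s \near x^'-, s \in `[a, b] -> `|f s| <= M.
    have [ax'|xa] := ltP a x.
      have [|l /side Hl] := fl x; first by rewrite in_itv /= ax'.
      by exists (`|l| + 1); apply: filterS Hl => s ->.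
    exists 0; near=> s.
    rewrite in_itv /= => /andP[sa _].
    have : s < x by near: s; exact: nbhs_left_lt.
    by rewrite ltNge (le_trans xa sa).
  pose M0 := Num.max `|f x| (Num.max Mr Ml).
  have H1 : \forall s \near x, s \in `[a, b] -> `|f s| <= M0.
    move: Hr Hl; rewrite !near_withinE => Hr Hl.
    apply: filter_app Hr; apply: filter_app Hl; near=> s => Hl Hr sab.
    rewrite !le_max; case: (ltgtP x s) => [xs|sx|<-]; last by rewrite lexx.
      by rewrite (Hr xs sab) /= orbT.
    by rewrite (Hl sx sab) !orbT.
  exists ([set s | s \in `[a, b] -> `|f s| <= M0], [set M | M0 <= M]).
    by split => //=; exact: (nbhs_pinfty_ge (num_real _)).
  by move=> [s M] /= [Hs HM] sab; exact: le_trans (Hs sab) HM.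
have /compact_near_coveringP/(_ _ _ _ _ loc) H := @segment_compact R a b.
have [M HM] : exists M, `[a, b] `<=` (fun t => t \in `[a, b] -> `|f t| <= M).
  exact: filter_ex H.
by exists M => t tab; exact: HM.
Unshelve. all: by end_near. Qed.

(** At an interior point the restriction to the segment is invisible. *)
Lemma is_derive_entry_within (R : realType) (n : nat) (X : R -> 'M[R]_n)
    (a b t : R) (l : 'M[R]_n) (i j : 'I_n) :
  t \in `]a, b[ -> has_derivative_within `[a, b] X t l ->
  is_derive t 1 (fun s => X s i j) (l i j).
Proof.
move=> tab Xl; apply/is_derive_difference_quotient.
have /= Xlij := cvg_entry (i := i) (j := j) _ Xl.
have tab' : \forall s \near t^', s \in `[a, b].
  apply: nbhs_dnbhs; move: tab; rewrite in_itv /= => /andP[at_ tb].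
  near=> s; rewrite in_itv /=; apply/andP; split; apply: ltW; near: s.
    exact: lt_nbhsr.
  exact: lt_nbhsl.
move=> U /Xlij; rewrite !near_simpl near_withinE.
by apply: filter_app; apply: filterS tab' => s sab /(_ sab); rewrite !mxE.
Unshelve. all: by end_near. Qed.

(** This is u' + C u >= 0 for u = |y|^2 and y' = A y.  Spread over all pairs
(i, k), each term is 2 A_ik y_i y_k + B (y_i^2 + y_k^2), a combination of the
squares of y_i + y_k and y_i - y_k with coefficients (B + A_ik) / 2 and
(B - A_ik) / 2. *)
Lemma sum_quadratic_form_ge0 (R : realType) (n : nat) (A : 'M[R]_n)
    (y : 'I_n -> R) (B : R) :
  (forall i j, `|A i j| <= B) ->
  0 <= \sum_i (y i * (\sum_k A i k * y k) *+ 2) + (B * n%:R *+ 2) * \sum_i y i ^+ 2.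
Proof.
move=> AB.
have -> : (B * n%:R *+ 2) * (\sum_i y i ^+ 2) =
    \sum_i \sum_k (B * (y i ^+ 2 + y k ^+ 2)).
  (* Both double sums are n times the sum of squares. *)
  transitivity (\sum_i (B * y i ^+ 2 * n%:R + B * \sum_k y k ^+ 2)).
    rewrite big_split /= sumr_const card_ord -!mulr_suml -mulr_sumr.
    by rewrite -[_ *+ n]mulr_natr -[_ *+ 2]mulr_natr; ring.
  apply: eq_bigr => i _; rewrite -mulr_sumr big_split /= sumr_const card_ord.
  by rewrite mulr_natr mulrDr mulrnAr.
rewrite -big_split /=; apply: sumr_ge0 => i _.
rewrite mulr_sumr -sumrMnl -big_split /=; apply: sumr_ge0 => k _.
have := AB i k; rewrite ler_norml => /andP[A1 A2].
have -> : y i * (A i k * y k) *+ 2 + B * (y i ^+ 2 + y k ^+ 2) =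
    ((B + A i k) * (y i + y k) ^+ 2 + (B - A i k) * (y i - y k) ^+ 2) / 2 by field.
rewrite divr_ge0 // addr_ge0 // mulr_ge0 ?sqr_ge0 ?subr_ge0 //.
by rewrite -lerBlDl sub0r.
Qed.

(** Gronwall's argument run backwards in time: for a large constant C the function
exp(C t) |X(t) v|^2 is nondecreasing, so a vector killed by X(s) would already
be killed by the identity matrix X(t0). *)
Lemma solution_nonsingular (R : realType) (n : nat) (t0 tf : R)
    (W X : R -> 'M[R]_n) :
  piecewise_continuous t0 tf W -> is_solution t0 tf W X ->
  forall s, s \in `[t0, tf] -> \det (X s) != 0.
Proof.
move=> Wpc [Xc X0 Xeq] s; rewrite in_itv /= => /andP[t0s stf].
rewrite -det_tr; apply/negP => /det0P[v v0 Xv].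
have [[/finite_seqP[D defD] _ _] [B WB]] := (Wpc, piecewise_continuous_bounded Wpc).
(* The row vector v satisfies v X(s)^T = 0, so y = X v^T vanishes at time s. *)
pose y t i : R := \sum_j X t i j * v 0 j.
pose u t : R := \sum_i y t i ^+ 2.
pose C : R := B * n%:R *+ 2.
pose g t : R := expR (C * t) * u t.
have ys i : y s i = 0.
  have /= := congr1 (fun M : 'rV_n => M 0 i) Xv; rewrite !mxE => Xvi.
  by rewrite -[RHS]Xvi; apply: eq_bigr => j _; rewrite mxE mulrC.
have y0 i : y t0 i = v 0 i.
  rewrite /y X0 (bigD1 i) //= big1 => [|j ji]; first by rewrite mxE eqxx mul1r addr0.
  by rewrite mxE eq_sym (negbTE ji) mul0r.
have gs : g s = 0 by rewrite /g /u big1 ?mulr0 // => i _; rewrite ys expr0n.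
have g0 : 0 < g t0.
  rewrite /g mulr_gt0 ?expR_gt0 // lt_neqAle sumr_ge0 ?andbT => [|i _];
    last exact: sqr_ge0.
  apply: contra v0 => /eqP/esym/psumr_eq0P u0.
  apply/eqP/rowP => i; rewrite mxE -y0; apply/eqP; rewrite -sqrf_eq0; apply/eqP.
  by apply: u0 => // k _; exact: sqr_ge0.
suff : g t0 <= g s by rewrite gs leNgt g0.
have Xc' : {within `[t0, s], continuous X}.
  by apply: continuous_subspaceW Xc; apply: subset_itvl; rewrite bnd_simp.
have yc i : {within `[t0, s], continuous (fun t => y t i)}.
  move=> t; apply: cvg_big => [|j _]; first exact: add_continuous.
  by apply: cvgM; [exact: cvg_entry (Xc' t)|exact: cvg_cst].
have gc : {within `[t0, s], continuous g}.
  move=> t; apply: cvgM.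
    apply: continuous_subspaceT => {}t.
    apply: (@continuous_comp _ _ _ (fun t => C * t) expR); last exact: continuous_expR.
    exact: mulrl_continuous.
  apply: cvg_big => [|i _]; first exact: add_continuous.
  by apply: cvgM; exact: yc.
apply: (@derive_ge0_off_finite_le _ D _
  (fun t => expR (C * t) * (\sum_i (y t i * (\sum_k W t i k * y t k) *+ 2) + C * u t))) => //.
move=> t; rewrite in_itv /= => /andP[t0t ts] tD.
have tab : t \in `[t0, tf] by rewrite in_itv /= (ltW t0t) (le_trans (ltW ts) stf).
have Wt : continuous_within_at `[t0, tf] W t.
  apply: contrapT => nWt; have : [set` D] t by rewrite -defD.
  by rewrite /= (negbTE tD).
split; last first.
  apply: mulr_ge0; first exact: expR_ge0.
  apply: sum_quadratic_form_ge0 => i j; apply: le_trans (WB _ tab).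
  rewrite [leRHS]/Num.Def.normr/= mx_normrE.
  exact: (le_bigmax _ _ (i, j)).
have Xd i j : is_derive t 1 (fun s => X s i j) ((W t *m X t) i j).
  apply: (@is_derive_entry_within R n X t0 tf); last exact: Xeq.
  by rewrite in_itv /= t0t (lt_le_trans ts).
have yd i : is_derive t 1 (y ^~ i) (\sum_k W t i k * y t k).
  have -> : y ^~ i = \sum_j (fun t => X t i j * v 0 j).
    by apply/funext => r; rewrite fct_sumE.
  apply: is_derive_eq.
  under [LHS]eq_bigr do rewrite scaler0 add0r mxE [_ *: _]mulr_sumr.
  rewrite exchange_big /=; apply: eq_bigr => k _; rewrite mulr_sumr.
  by apply: eq_bigr => j _; rewrite mulrC mulrA.
have -> : g = (fun t => expR (C * t)) * \sum_i (y ^~ i) ^+ 2.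
  by apply/funext => r; rewrite /g /= fctE fct_sumE.
apply: is_derive_eq.
rewrite mulrDr; congr (_ + _).
  congr (_ * _); apply: eq_bigr => i _.
  by rewrite /GRing.scale /= expr1; ring.
by rewrite fct_sumE /GRing.scale /= mulr1 mulrCA; congr (_ * _); rewrite mulrC.
Qed.

Lemma solution_det_gt0 (R : realType) (n : nat) (t0 tf : R)
    (W X : R -> 'M[R]_n) :
  t0 <= tf -> piecewise_continuous t0 tf W -> is_solution t0 tf W X ->
  0 < \det (X tf).
Proof.
move=> t0tf Wpc XW; have [Xc X0 _] := XW; rewrite ltNge; apply/negP => detX.
have detc : {within `[t0, tf], continuous (fun t => \det (X t))}.
  by move=> t; exact: det_cvg (Xc t).
have [|c ct detc0] := IVT (v := 0) t0tf detc.
  by rewrite X0 det1 ge_min le_max detX ler01 orbT.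
by have := solution_nonsingular Wpc XW ct; rewrite detc0 eqxx.
Qed.

(** * Generation of the matrices of positive determinant *)

(** A transvection for i != j, a rescaling of coordinate i for i = j. *)
Definition elem_mx (F : comNzRingType) (n : nat) (i j : 'I_n) (s : F) : 'M[F]_n :=
  1%:M + s *: delta_mx i j.

Lemma delta_mxM (F : comNzRingType) (n : nat) (i j k l : 'I_n) :
  delta_mx i j *m delta_mx k l = (j == k)%:R *: delta_mx i l :> 'M[F]_n.
Proof.
case: (eqVneq j k) => [->|jk]; first by rewrite mul_delta_mx scale1r.
by rewrite mul_delta_mx_0 ?scale0r.
Qed.

Lemma elem_mx_commutator (F : comNzRingType) (n : nat) (i k l : 'I_n) (s : F) :
  i != k -> k != l -> i != l ->
  elem_mx i l s =
  elem_mx i k 1 *m elem_mx k l s *m elem_mx i k (-1) *m elem_mx k l (- s).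
Proof.
move=> ik kl il.
have [ki lk li] : [/\ (k == i) = false, (l == k) = false & (l == i) = false].
  by rewrite ![_ == i]eq_sym [l == k]eq_sym; split; exact: negbTE.
rewrite /elem_mx !(mulmxDl, mulmxDr, mulmx1, mul1mx, =^~ scalemxAl, =^~ scalemxAr,
  delta_mxM, eqxx, ki, lk, li, scale0r, scale1r, scaler0, mul0mx, addr0).
by apply/matrixP => p q; rewrite !mxE; ring.
Qed.

(** Induction on a path from i to j: its first edge (i, k) and the transvection
from k to j provided by the rest of the path combine into a commutator.  When
i = k or k = j only one of the two is available, but it is already the result. *)
Lemma connected_elem_mx (F : comNzRingType) (n : nat) (E : rel 'I_n)
    (P : 'M[F]_n -> Prop) :
  (forall A B, P A -> P B -> P (A *m B)) ->
  (forall i j s, E i j -> i != j -> P (elem_mx i j s)) ->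
  forall i j, connect E i j -> i != j -> forall s, P (elem_mx i j s).
Proof.
move=> PM PE i j /connectP[p + ->] {j}.
elim: p i => [|k p IH] i /=; first by rewrite eqxx.
move=> /andP[Eik path_p] il s.
case: (eqVneq i k) => [ik|ik]; first by rewrite ik in il *; exact: IH.
case: (eqVneq k (last k p)) => [kl|kl]; first by rewrite -kl; exact: PE.
rewrite (elem_mx_commutator s ik kl il).
by apply: (PM _ _ (PM _ _ (PM _ _ _ _) _)); [exact: PE|exact: IH|exact: PE|exact: IH].
Qed.

(** C |-> block_mx 1 0 C 1 turns sums into products, and C is the sum of its
entries times matrix units. *)
Lemma lower_block_generated (F : comNzRingType) (m n : nat)
    (P : 'M[F]_(m + n) -> Prop) :
  P 1%:M -> (forall A B, P A -> P B -> P (A *m B)) ->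
  (forall i j s, P (elem_mx (rshift m i) (lshift n j) s)) ->
  forall C, P (block_mx 1%:M 0 C 1%:M).
Proof.
move=> P1 PM PE C.
rewrite [C]matrix_sum_delta.
apply: (big_ind (fun C => P (block_mx 1%:M 0 C 1%:M))) => [|A B PA PB|i _].
- by rewrite -scalar_mx_block.
- have := PM _ _ PA PB.
  by rewrite mulmx_block !(mul1mx, mulmx1, mul0mx, mulmx0, addr0, add0r).
apply: (big_ind (fun C => P (block_mx 1%:M 0 C 1%:M))) => [|A B PA PB|j _].
- by rewrite -scalar_mx_block.
- have := PM _ _ PA PB.
  by rewrite mulmx_block !(mul1mx, mulmx1, mul0mx, mulmx0, addr0, add0r).
have := PE i j (C i j).
congr P; rewrite /elem_mx delta_mx_dshift delta_mx_lshift.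
rewrite scale_col_mx scale_row_mx !scaler0 scalar_mx_block.
have -> : col_mx 0 (row_mx (C i j *: delta_mx i j) 0) =
  block_mx 0 0 (C i j *: delta_mx i j) 0 :> 'M[F]_(m + n, m + n).
      by rewrite /block_mx row_mx0.
by rewrite add_block_mx !addr0 add0r.
Qed.

Lemma upper_block_generated (F : comNzRingType) (m n : nat)
    (P : 'M[F]_(m + n) -> Prop) :
  P 1%:M -> (forall A B, P A -> P B -> P (A *m B)) ->
  (forall i j s, P (elem_mx (lshift n i) (rshift m j) s)) ->
  forall C, P (block_mx 1%:M C 0 1%:M).
Proof.
move=> P1 PM PE C.
suff /(_ C^T) : forall D, P (block_mx 1%:M 0 D 1%:M)^T.
  by rewrite tr_block_mx !trmx1 trmx0 trmxK.
apply: (lower_block_generated (P := fun A => P A^T)).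
- by rewrite trmx1.
- by move=> A B PA PB; rewrite trmx_mul; exact: PM.
- move=> i j s; rewrite /elem_mx linearD linearZ /= trmx1 trmx_delta.
  exact: PE.
Qed.

Lemma mulmx_lower_block (F : comNzRingType) (m n : nat) (C : 'M[F]_(n, m))
    (A : 'M[F]_m) (B : 'M[F]_(m, n)) (D : 'M[F]_(n, m)) (G : 'M[F]_n) :
  block_mx 1%:M 0 C 1%:M *m block_mx A B D G =
  block_mx A B (C *m A + D) (C *m B + G).
Proof. by rewrite mulmx_block !(mul1mx, mul0mx, addr0). Qed.

Lemma mulmx_upper_block (F : comNzRingType) (m n : nat) (C : 'M[F]_(m, n))
    (A : 'M[F]_m) (B : 'M[F]_(m, n)) (D : 'M[F]_(n, m)) (G : 'M[F]_n) :
  block_mx 1%:M C 0 1%:M *m block_mx A B D G =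
  block_mx (A + C *m D) (B + C *m G) D G.
Proof. by rewrite mulmx_block !(mul1mx, mul0mx, addr0, add0r). Qed.

(** Generation is phrased through an arbitrary multiplicatively closed P, so that
the induction on the size can apply it to the pullback of P under
S |-> block_mx 1 0 0 S. *)
Definition generates_GLplus (F : realFieldType) (n : nat) : Prop :=
  forall P : 'M[F]_n -> Prop,
  P 1%:M -> (forall A B, P A -> P B -> P (A *m B)) ->
  (forall i j s, 0 < 1 + s *+ (i == j) -> P (elem_mx i j s)) ->
  forall T, 0 < \det T -> P T.

(** Elimination on the block matrix with blocks a, r, c, B, where a is scalar.  If
a > 0, the Schur complement of a has positive determinant and is covered by the
induction hypothesis.  If c != 0, adding a combination of the lower rows to the
first one makes the pivot equal to 1.  If c = 0 and a < 0, there is a lower row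
because the determinant is positive, and adding the first row to the lower ones
makes c nonzero. *)
Lemma elem_mx_generate_step (F : realFieldType) (n : nat) :
  generates_GLplus F n -> generates_GLplus F (1 + n).
Proof.
move=> IH P P1 PM PE.
have PL C : P (block_mx (1%:M : 'M[F]_1) 0 C (1%:M : 'M[F]_n)).
  apply: lower_block_generated => // i j s; apply: PE.
  by rewrite eq_rlshift mulr0n addr0.
have PU C : P (block_mx (1%:M : 'M[F]_1) C 0 (1%:M : 'M[F]_n)).
  apply: upper_block_generated => // i j s; apply: PE.
  by rewrite eq_lrshift mulr0n addr0.
have Plower C T : P (block_mx (1%:M : 'M[F]_1) 0 C 1%:M *m T) -> P T.
  move=> PT; have := PM _ _ (PL (- C)) PT.
  by rewrite mulmxA mulmx_lower_block mulmx1 addNr mulmx0 add0r -scalar_mx_block mul1mx.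
have Pupper C T : P (block_mx (1%:M : 'M[F]_1) C 0 1%:M *m T) -> P T.
  move=> PT; have := PM _ _ (PU (- C)) PT.
  by rewrite mulmxA mulmx_upper_block mulmx1 mulmx0 addr0 subrr -scalar_mx_block mul1mx.
have pivot_gt0 (a : F) (r : 'rV_n) (c : 'cV_n) B : 0 < a ->
    0 < \det (block_mx a%:M r c B) -> P (block_mx (a%:M : 'M[F]_1) r c B).
  move=> a0 det_gt0.
  apply: (Plower (- a^-1 *: c)).
  have a_neq0 : a != 0 by rewrite gt_eqF.
  have E : block_mx (1%:M : 'M[F]_1) 0 (- a^-1 *: c) 1%:M *m block_mx a%:M r c B =
     block_mx (a%:M : 'M[F]_1) r 0 (B - a^-1 *: c *m r).
    rewrite mulmx_lower_block mul_mx_scalar scalerA mulrN divff// scaleN1r addNr.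
    by rewrite scaleNr mulNmx addrC.
  rewrite E; move: det_gt0.
  have -> : \det (block_mx a%:M r c B) = a * \det (B - a^-1 *: c *m r).
    have := congr1 determinant E.
    by rewrite det_mulmx det_lblock det_ublock !det1 det_scalar1 !mul1r.
  rewrite pmulr_rgt0 // => det_gt0.
  set S := B - _ in det_gt0 *.
  have PS : P (block_mx (1%:M : 'M[F]_1) 0 0 S).
    apply: (IH (fun S => P (block_mx (1%:M : 'M[F]_1) 0 0 S))) => //.
    - move=> A A' PA PA'; have := PM _ _ PA PA'.
      by rewrite mulmx_block !(mulmx0, mul0mx, mul1mx, addr0, add0r).
    - move=> i j s hs; have := PE (rshift 1 i) (rshift 1 j) s.
      rewrite eq_rshift => /(_ hs); congr P.
      rewrite /elem_mx delta_mx_dshift delta_mx_rshift.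
      rewrite scale_col_mx scale_row_mx !scaler0 scalar_mx_block.
      have -> : col_mx 0 (row_mx 0 (s *: delta_mx i j)) =
        block_mx 0 0 0 (s *: delta_mx i j) :> 'M[F]_(1 + n, 1 + n).
      by rewrite /block_mx row_mx0.
      by rewrite add_block_mx !addr0.
  have PD : P (block_mx (a%:M : 'M[F]_1) 0 0 1%:M).
    have := PE (lshift n 0) (lshift n 0) (a - 1).
    rewrite eqxx mulr1n addrC subrK => /(_ a0); congr P.
    rewrite /elem_mx delta_mx_ushift delta_mx_lshift.
    rewrite scale_col_mx scale_row_mx !scaler0 scalar_mx_block.
    have -> : col_mx (row_mx ((a - 1) *: delta_mx 0 0) 0) 0 =
      block_mx ((a - 1) *: delta_mx 0 0) 0 0 0 :> 'M[F]_(1 + n, 1 + n).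
      by rewrite /block_mx row_mx0.
    rewrite add_block_mx !addr0; congr block_mx.
    by apply/matrixP => i j; rewrite !ord1 !mxE eqxx !mulr1n mulr1 addrC subrK.
  have := PM _ _ (PM _ _ PS (PU r)) PD.
  by rewrite !mulmx_block !(mulmx0, mul0mx, mul1mx, mulmx1, addr0, add0r).
have column_neq0 (a : F) (r : 'rV_n) (c : 'cV_n) B : c != 0 ->
    0 < \det (block_mx a%:M r c B) -> P (block_mx (a%:M : 'M[F]_1) r c B).
  move=> /matrix0Pn[i [j]]; rewrite ord1 {j} => ci det_gt0.
  (* The multiplier solves a + x c_i = 1. *)
  pose r' : 'rV[F]_n := ((1 - a) / c i 0) *: delta_mx 0 i.
  have pivot1 : a%:M + r' *m c = 1%:M.
    apply/matrixP => p q; rewrite !ord1 -scalemxAl -rowE !mxE !mulr1n divfK//.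
    by rewrite addrC subrK.
  apply: (Pupper r'); rewrite mulmx_upper_block pivot1; apply: pivot_gt0 => //.
  by rewrite -pivot1 -mulmx_upper_block det_mulmx det_ublock !det1 !mul1r.
move=> T det_gt0.
have defT : T = block_mx (T 0 0)%:M (ursubmx T) (dlsubmx T) (drsubmx T).
  rewrite -[LHS]submxK; congr block_mx; apply/matrixP => i j.
  by rewrite !ord1 !mxE mulr1n; congr (T _ _); exact: val_inj.
move: (T 0 0) (ursubmx T) (dlsubmx T) (drsubmx T) defT => a r c B defT.
rewrite defT in det_gt0 *.
have [c0|] := eqVneq c 0; last by move=> c0; exact: column_neq0.
have [a0|a_le0] := ltP 0 a; first exact: pivot_gt0.
rewrite {}c0 in det_gt0 *.
(* The new lower column is the constant a, which is nonzero. *)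
apply: (Plower (const_mx 1)); rewrite mulmx_lower_block; apply: column_neq0.
  rewrite addr0 mul_mx_scalar scaler_eq0.
  move: det_gt0; rewrite det_ublock det_scalar1 => det_gt0.
  have a_neq0 : a != 0 by apply: contraTneq det_gt0 => ->; rewrite mul0r ltxx.
  rewrite (negbTE a_neq0) /=; apply/matrix0Pn.
  have [n0|n_gt0] := posnP n; last by exists (Ordinal n_gt0), 0; rewrite mxE oner_eq0.
  by subst n; move: det_gt0; rewrite det_mx00 mulr1 ltNge a_le0.
by rewrite -mulmx_lower_block det_mulmx det_lblock !det1 !mul1r.
Qed.

Lemma elem_mx_generate_GLplus (F : realFieldType) (n : nat) :
  generates_GLplus F n.
Proof.
elim: n => [|n IH]; last exact: elem_mx_generate_step.
by move=> P P1 _ _ T _; have -> : T = 1%:M by apply/matrixP => -[].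
Qed.

(** * Steering *)

Lemma is_derive_mul_norm (R : realType) (t : R) :
  is_derive t 1 (fun x : R => x * `|x|) (2 * `|t|).
Proof.
(* On each side of 0 the function is a multiple k of the square, with k = 1 or -1. *)
have sqd (k : R) : is_derive t 1 (fun x : R => k * x ^+ 2) (k * (2 * t)).
  apply: is_derive_eq.
  by rewrite /GRing.scale /= mulr1; ring.
case: (ltrgt0P t) => [t0|t0|->].
- apply: (@near_eq_is_derive _ _ _ (fun x : R => 1 * x ^+ 2)).
    near=> x; have x0 : 0 < x by near: x; exact: lt_nbhsr.
    by rewrite mul1r gtr0_norm.
  by apply: is_derive_eq; rewrite mul1r.
- apply: (@near_eq_is_derive _ _ _ (fun x : R => -1 * x ^+ 2)).
    near=> x; have x0 : x < 0 by near: x; exact: lt_nbhsl.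
    by rewrite ltr0_norm // mulrN mulN1r.
  by apply: is_derive_eq; rewrite mulN1r mulrN.
- rewrite mulr0; apply/is_derive_difference_quotient.
  apply: (@cvg_trans _ (`|x| @[x --> 0^'])).
    apply: near_eq_cvg; near=> x.
    have x0 : x != 0 by near: x; exact: nbhs_dnbhs_neq.
    by rewrite mul0r !subr0 mulKf.
  apply: cvg_within_filter.
  have := @norm_continuous R R 0; rewrite /continuous_at normr0; exact.
Unshelve. all: by end_near. Qed.

(** The function x |x| is C^1 with derivative 2 |x|, so its second difference
u |u| - 2 (u - 1) |u - 1| + (u - 2) |u - 2| is C^1 as well; it is equal to -2 for
u <= 0 and to 2 for u >= 2.  Here u = c (t - a) maps the interval from a to b
onto the one from 0 to 2. *)
Lemma smooth_step (R : realType) (a b : R) : a < b ->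
  exists th dth : R -> R,
  [/\ continuous dth, forall t : R, is_derive t 1 th (dth t),
      forall t, 0 <= th t <= 1,
      forall t, t <= a -> th t = 0 /\ dth t = 0
    & forall t, b <= t -> th t = 1 /\ dth t = 0].
Proof.
move=> ab; have ba0 : 0 < b - a by rewrite subr_gt0.
pose c := 2 / (b - a); pose m := (a + b) / 2.
have c0 : 0 < c by rewrite divr_gt0.
pose r (p x : R) := (c * (x - p)) * `|c * (x - p)|.
pose dr (p x : R) := 2 * `|c * (x - p)| * c.
have rd (p t : R) : is_derive t 1 (r p) (dr p t).
  pose h x : R := c * (x - p).
  have hd : is_derive t 1 h c.
    by apply: is_derive_eq; rewrite /GRing.scale /= subr0 mulr1 // mulr0 addr0.
  have := is_derive1_comp (is_derive_mul_norm (h t)) hd.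
  exact.
have drc p : continuous (dr p).
  move=> x; apply: cvgM; last exact: cvg_cst.
  apply: cvgM; first exact: cvg_cst.
  apply: cvg_norm; apply: cvgM; first exact: cvg_cst.
  by apply: cvgB; [exact: cvg_id|exact: cvg_cst].
pose th x := (r a x - 2 * r m x + r b x + 2) / 4.
pose dth x := (dr a x - 2 * dr m x + dr b x) / 4.
have E x : [/\ c * (x - m) = c * (x - a) - 1 & c * (x - b) = c * (x - a) - 2].
  by rewrite /c /m; split; field; rewrite gt_eqF.
have ca t : (c * (t - a) <= 0) = (t <= a) by rewrite pmulr_rle0 // subr_le0.
have cb t : (2 <= c * (t - a)) = (b <= t).
  have [_ Eb] := E t.
  by rewrite -subr_ge0 -Eb pmulr_rge0 // subr_ge0.
exists th, dth; split.
- move=> x; apply: cvgM; last exact: cvg_cst.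
  apply: cvgD; last exact: drc.
  by apply: cvgB; [exact: drc|apply: cvgM; [exact: cvg_cst|exact: drc]].
- move=> t; rewrite /th /dth.
  apply: is_derive_eq.
  by rewrite !scaler0 add0r addr0 /GRing.scale /= mulrC.
- move=> t; rewrite /th /r; have [-> ->] := E t.
  set u := c * (t - a).
  by case: (ler0P u) => u0; case: (ler0P (u - 1)) => u1; case: (ler0P (u - 2)) => u2;
    apply/andP; split; nra.
- move=> t; rewrite -ca => ta; rewrite /th /dth /r /dr; have [-> ->] := E t.
  set u := c * (t - a) in ta *.
  by rewrite !ler0_norm; [split; field|lra|lra|lra].
- move=> t; rewrite -cb => ta; rewrite /th /dth /r /dr; have [-> ->] := E t.
  set u := c * (t - a) in ta *.
  by rewrite !ger0_norm; [split; field|lra|lra|lra].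
Qed.

(** W and X live on the whole line, at rest outside the interval from a to b, so
that successive motions combine by global formulas. *)
Definition steers (R : realType) (n : nat) (E : rel 'I_n) (a b : R)
    (M : 'M[R]_n) : Prop :=
  exists W X : R -> 'M[R]_n,
  [/\ continuous W, forall t, sparse E (W t),
      forall t i j, is_derive (t : R) 1 (fun s => X s i j) ((W t *m X t) i j),
      forall t, t <= a -> W t = 0 /\ X t = 1%:M
    & forall t, b <= t -> W t = 0 /\ X t = M].

Lemma steers_id (R : realType) (n : nat) (E : rel 'I_n) (a b : R) :
  steers E a b 1%:M.
Proof.
exists (fun=> 0), (fun=> 1%:M); split=> //.
- by move=> t; exact: cvg_cst.
- by move=> t i j _; rewrite mxE.
- by move=> t i j; rewrite mul0mx [X in is_derive _ _ _ X]mxE; exact: is_derive_cst.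
Qed.

(** X2 X1 has derivative W2 X2 X1 + X2 W1 X1, and X2 commutes with W1 at all
times: up to m the second motion has not started, so X2 = 1, and from m on the
first one is over, so W1 = 0. *)
Lemma steers_mul (R : realType) (n : nat) (E : rel 'I_n) (a m b : R)
    (A B : 'M[R]_n) :
  a <= m -> m <= b -> steers E a m A -> steers E m b B -> steers E a b (B *m A).
Proof.
move=> am mb [W1 [X1 [c1 s1 d1 l1 r1]]] [W2 [X2 [c2 s2 d2 l2 r2]]].
exists (fun t => W1 t + W2 t), (fun t => X2 t *m X1 t); split.
- by move=> t; apply: cvgD; [exact: c1|exact: c2].
- by move=> t i j nE; rewrite mxE (s1 t _ _ nE) (s2 t _ _ nE) addr0.
- move=> t i j.
  have := is_derive_mulmx (fun k => d2 t i k) (fun k => d1 t k j).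
  congr (is_derive t 1 _ (_ i j)).
  rewrite mulmxDl addrC !mulmxA; congr (_ *m _ + _).
  case: (leP t m) => tm.
    by have [_ ->] := l2 _ tm; rewrite mul1mx mulmx1.
  by have [-> _] := r1 _ (ltW tm); rewrite mulmx0 mul0mx.
- move=> t ta; have [-> ->] := l1 _ ta; have [-> ->] := l2 _ (le_trans ta am).
  by rewrite addr0 mulmx1.
- move=> t bt; have [-> ->] := r2 _ bt; have [-> ->] := r1 _ (le_trans mb bt).
  by rewrite addr0.
Qed.

(** With theta the step from 0 to 1, X = 1 + s theta E_ij satisfies X' = W X for
W = s theta' / (1 + s theta [i = j]) E_ij.  The denominator lies between 1 and
1 + s [i = j], hence is positive. *)
Lemma steers_elem (R : realType) (n : nat) (E : rel 'I_n) (a b : R)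
    (i j : 'I_n) (s : R) :
  a < b -> E i j -> 0 < 1 + s *+ (i == j) -> steers E a b (elem_mx i j s).
Proof.
move=> ab Eij s_gt0; have [th [dth [dthc thd th01 thl thr]]] := smooth_step ab.
pose p t := 1 + (s * th t) *+ (i == j).
have p_gt0 t : 0 < p t.
  have /andP[t0 t1] := th01 t; move: s_gt0; rewrite /p.
  by case: (i == j); rewrite ?mulr1n ?mulr0n; case: (lerP 0 s) => s0; nra.
exists (fun t => (s * dth t / p t) *: delta_mx i j), (fun t => elem_mx i j (s * th t)).
split.
- move=> t; apply: cvgZr_tmp; apply: cvgM.
    by apply: cvgM; [exact: cvg_cst|exact: dthc].
  apply: cvgV; first by rewrite gt_eqF.
  apply: cvgD; first exact: cvg_cst.
  have thc : th x @[x --> t] --> th t.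
    apply/differentiable_continuous/derivable1_diffP.
    exact: (@ex_derive _ _ _ _ _ _ _ (thd t)).
  case: (i == j); last exact: cvg_cst.
  by apply: cvgM; [exact: cvg_cst|exact: thc].
- move=> t k l nE; rewrite !mxE; case: eqP => [ki|_]; last by rewrite mulr0.
  case: eqP => [lj|_]; last by rewrite mulr0.
  by rewrite ki lj Eij in nE.
- move=> t k l.
  have -> : (s * dth t / p t) *: delta_mx i j *m elem_mx i j (s * th t) =
      (s * dth t) *: delta_mx i j.
    rewrite /elem_mx mulmxDr mulmx1 -scalemxAl -scalemxAr delta_mxM scalerA.
    rewrite !scalerA -scalerDl; congr (_ *: _).
    have := p_gt0 t; rewrite /p [j == i]eq_sym.
    case: (i == j); rewrite ?mulr1n ?mulr0n => pt.
      by field; rewrite gt_eqF.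
    by field.
  have thkl : is_derive t 1
      (fun r : R => (1%:M : 'M[R]_n) k l + s * th r * delta_mx i j k l)
      (((s * dth t) *: delta_mx i j : 'M[R]_n) k l).
    apply: is_derive_eq.
    by rewrite scaler0 !add0r mul1r [RHS]mxE /GRing.scale /= mulrC.
  move: thkl; congr (is_derive t 1 _ _).
  by apply/funext => r; rewrite [RHS]mxE [X in _ = _ + X]mxE.
- move=> t /thl[-> ->]; split; first by rewrite mulr0 mul0r scale0r.
  by rewrite /elem_mx mulr0 scale0r addr0.
- move=> t /thr[-> ->]; split; first by rewrite mulr0 mul0r scale0r.
  by rewrite mulr1.
Qed.

Lemma steers_GLplus (R : realType) (n : nat) (E : rel 'I_n) (T : 'M[R]_n) :
  reflexive E -> (forall i j, connect E i j) -> 0 < \det T ->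
  forall a b : R, a < b -> steers E a b T.
Proof.
move=> Eref Econ.
have PM (A B : 'M[R]_n) : (forall a b : R, a < b -> steers E a b A) ->
    (forall a b : R, a < b -> steers E a b B) ->
    forall a b : R, a < b -> steers E a b (A *m B).
  move=> PA PB a b ab; have [am mb] := midf_lt ab.
  by apply: (steers_mul (ltW am) (ltW mb)); [exact: PB|exact: PA].
move: T; apply: (@elem_mx_generate_GLplus R n
  (fun T => forall a b : R, a < b -> steers E a b T)) => //.
- by move=> a b _; exact: steers_id.
- move=> i j s; case: (eqVneq i j) => [<- s_gt0 a b ab|ij _].
    by apply: steers_elem => //; rewrite ?Eref ?eqxx.
  apply: (connected_elem_mx PM) (Econ i j) ij s => {i j} i j s Eij ij a b ab.
  by apply: steers_elem => //; rewrite (negbTE ij) addr0.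
Qed.

(** A derivative on the whole line restricts to a one-sided one at each endpoint,
and entrywise limits are limits of matrices. *)
Lemma steers_solution (R : realType) (n : nat) (E : rel 'I_n) (a b : R)
    (M : 'M[R]_n) :
  steers E a b M ->
  exists W : R -> 'M[R]_n,
  [/\ continuous W, forall t, sparse E (W t)
    & exists2 X : R -> 'M[R]_n, is_solution a b W X & X b = M].
Proof.
move=> [W [X [Wc Ws Xd Xa Xb]]]; exists W; split=> //.
exists X; last by have [] := Xb _ (lexx b).
split; last 1 first.
- move=> t _ _; apply: cvg_entrywise => i j.
  under eq_fun do rewrite 3!mxE.
  apply: cvg_within_filter.
  by have /is_derive_difference_quotient := Xd t i j.
- apply: continuous_subspaceT => t; apply: cvg_entrywise => i j.
  apply/differentiable_continuous/derivable1_diffP.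
  exact: (@ex_derive _ _ _ _ _ _ _ (Xd t i j)).
- by have [] := Xa _ (lexx a).
Qed.

Unset Implicit Arguments.
Set Strict Implicit.

Theorem theorem1 (R : realType) (n : nat) (hn : (1 <= n)%N) (E : rel 'I_n)
    (hE : undirected_with_loops E) (hconn : connected_graph E)
    (t0 tf : R) (ht : t0 < tf) (T : 'M[R]_n) :
  (exists W : R -> 'M[R]_n,
     [/\ piecewise_continuous t0 tf W,
         forall t, t \in `[t0, tf] -> sparse E (W t)
       & exists2 X : R -> 'M[R]_n, is_solution t0 tf W X & X tf = T])
  <-> GLplus T.
Proof.
split=> [[W [Wpc _ [X XW <-]]]|detT].
  exact: solution_det_gt0 (ltW ht) Wpc XW.
have [W [Wc Ws XW]] := steers_solution (steers_GLplus hE.1 hconn detT ht).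
by exists W; split=> //; exact: continuous_piecewise.
Qed.
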